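(* Let $N\ge1$, $a_n>0$ for $1\le n\le N$, and $b_n>0$ for $1\le n\le N-1$. Let the polynomials $P_n$ be defined by $$P_n(z)=(z-a_n)P_{n-1}(z)-b_{n-1}zP_{n-2}(z),\qquad 1\le n\le N,$$ with $P_0\equiv1$ and $P_{-1}\equiv0$. Let $\lambda_j,w_j$ ($1\le j\le N$) be the spectral data associated with $a_n,b_n$. Then $$\sum_{j=1}^N P_m(\lambda_j)P_n(\lambda_j)\frac{w_j}{\lambda_j^n}=\delta_{m,n}\prod_{k=1}^n b_k,\qquad 0\le m\le n\le N-1.$$
   Context: Convention: $b_0\equiv0$. $L$ is the $N\times N$ upper bidiagonal matrix with $L_{n,n}=a_n$, $L_{n,n+1}=1$, all other entries $0$; $M$ is the $N\times N$ lower bidiagonal matrix with $M_{n,n}=1$, $M_{n+1,n}=-b_n$, all other entries $0$. The generalized eigenvalue problem $L\vec x=\lambda M\vec x$ has $N$ distinct positive eigenvalues (the zeros of $\det(zM-L)$), denoted $0<\lambda_1<\cdots<\lambda_N$. For each $j$ let $\vec v_j$ and $\vec u_j$ be the right and left eigenvectors, $L\vec v_j=\lambda_j M\vec v_j$ and $\vec u_j^{\,T}L=\lambda_j\vec u_j^{\,T}M$, both normalized to have first component equal to $1$ (always possible). Then $\vec u_j^{\,T}M\vec v_j\ne 0$ and $w_j=(\vec u_j^{\,T}M\vec v_j)^{-1}$. An empty product equals $1$. *)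

(* Defs.v *)
From mathcomp Require Import all_boot all_order all_algebra reals.

Set Implicit Arguments.
Unset Strict Implicit.
Unset Printing Implicit Defensive.

Import Order.TTheory GRing.Theory Num.Theory.
Local Open Scope ring_scope.

(* Conventions: the coefficients are sequences a, b : nat -> R numbered from 1
   (only a_1..a_N and b_1..b_(N-1) are relevant, and b_0 = 0), whereas rows,
   columns and eigenvalues are numbered from 0 by 'I_N: row i of a matrix is
   row i.+1 of the mathematical text. *)

Definition Lmx (R : realType) (N : nat) (a : nat -> R) : 'M[R]_N :=
  \matrix_(i < N, j < N)
    if j == i :> nat then a i.+1 else if j == i.+1 :> nat then 1 else 0.

Definition Mmx (R : realType) (N : nat) (b : nat -> R) : 'M[R]_N :=
  \matrix_(i < N, j < N)
    if i == j :> nat then 1 else if i == j.+1 :> nat then - b j.+1 else 0.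

Definition gen_eigenvalue (R : realType) (N : nat) (L M : 'M[R]_N) (z : R) :
    Prop :=
  exists2 x : 'cV[R]_N, x != 0 & L *m x = z *: (M *m x).

Definition first_component1 (R : realType) (N : nat) (x : 'cV[R]_N) : Prop :=
  forall i : 'I_N, i = 0%N :> nat -> x i 0 = 1.

(* The normalized eigenvectors v, u are unique for each eigenvalue, so the
   existential quantifiers below determine w. *)
Record spectral_data (R : realType) (N : nat) (a b : nat -> R)
    (lambda w : 'I_N -> R) : Prop := SpectralData {
  lambda_gt0 : forall j, 0 < lambda j;
  lambda_incr : forall i j : 'I_N, (i < j)%N -> lambda i < lambda j;
  lambda_eigen : forall z : R,
    gen_eigenvalue (Lmx N a) (Mmx N b) z <-> exists j, z = lambda j;
  weightE : forall j, exists v u : 'cV[R]_N,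
    [/\ Lmx N a *m v = lambda j *: (Mmx N b *m v),
        u^T *m Lmx N a = lambda j *: (u^T *m Mmx N b),
        first_component1 v, first_component1 u
      & w j = ((u^T *m Mmx N b *m v) 0 0)^-1] }.

(* The pair (P_n, P_(n-1)), which starts at (P_0, P_(-1)) = (1, 0). *)
Fixpoint Ppair (R : realType) (a b : nat -> R) (n : nat) :
    {poly R} * {poly R} :=
  if n is n'.+1 then
    let: (p, q) := Ppair a b n' in
    (('X - (a n)%:P) * p - (b n')%:P * 'X * q, p)
  else (1, 0).

Definition P (R : realType) (a b : nat -> R) (n : nat) : {poly R} :=
  (Ppair a b n).1.

(* Main.v *)
(* The recurrences read off from L v = lambda M v and u^T L = lambda u^T M force
   v_i = P_i(lambda) and lambda^i b_1...b_i u_i = P_i(lambda) (rows numbered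
   from 0).  Let V and U have the right and left eigenvectors as columns and put
   W = diag(w_j).  Biorthogonality makes U^T M V diagonal, and it is invertible
   because V is a unitriangular matrix times a Vandermonde matrix.  Hence
   V W U^T is the inverse of the lower unitriangular matrix M, so its entries
   (m, n) with m <= n are those of the identity, which is the claim. *)
Require Import Defs.
From mathcomp Require Import all_boot all_order all_algebra reals ring.

Import Order.TTheory GRing.Theory Num.Theory.
Local Open Scope ring_scope.

Lemma sum_supp2 (V : nmodType) (I : finType) (F : I -> V) (i k : I) :
  i != k -> (forall j, j != i -> j != k -> F j = 0) -> \sum_j F j = F i + F k.
Proof.
move=> neq_ik F0; rewrite (bigD1 i) //= (bigD1 k) 1?eq_sym //= big1 ?addr0 //.
by move=> j /andP[ji jk]; apply: F0.
Qed.

Lemma sum_supp1 (V : nmodType) (I : finType) (F : I -> V) (i : I) :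
  (forall j, j != i -> F j = 0) -> \sum_j F j = F i.
Proof. by move=> F0; rewrite (bigD1 i) //= big1 ?addr0. Qed.

Lemma succ_neq (N : nat) (i k : 'I_N) : k = i.+1 :> nat -> i != k.
Proof. by move=> ki; rewrite -val_eqE /= ki neq_ltn ltnSn. Qed.

Section BidiagonalProducts.
Variables (R : realType) (N p : nat) (a b : nat -> R).
Implicit Types (i k : 'I_N).

(** The neighbour is an ordinal [k] tied to [i] by value, so both indices are in range. This leaves
    out the last row, whose eigenvector equation would say [P_N(z) = 0]. *)
Lemma Lmx_mulE (K : 'M[R]_(N, p)) i k j : k = i.+1 :> nat ->
  (Lmx N a *m K) i j = a i.+1 * K i j + K k j.
Proof.
move=> ki; rewrite mxE (sum_supp2 _ _ _ _ _ (succ_neq _ _ _ ki)) ?mxE.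
  by rewrite eqxx ki gtn_eqF // eqxx mul1r.
by move=> l li lk; rewrite mxE -ki !val_eqE (negbTE li) (negbTE lk) mul0r.
Qed.

Lemma Mmx_mulE (K : 'M[R]_(N, p)) i k j : k = i.+1 :> nat ->
  (Mmx N b *m K) k j = K k j - b k * K i j.
Proof.
move=> ki; rewrite mxE (sum_supp2 _ _ _ _ _ (succ_neq _ _ _ ki)) ?mxE.
  by rewrite eqxx ki gtn_eqF // eqxx mul1r mulNr addrC.
move=> l li lk; rewrite mxE ki eqSS -ki !val_eqE [k == l]eq_sym [i == l]eq_sym.
by rewrite (negbTE li) (negbTE lk) mul0r.
Qed.

Lemma Mmx_mulE0 (K : 'M[R]_(N, p)) i j : i = 0%N :> nat ->
  (Mmx N b *m K) i j = K i j.
Proof.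
move=> i0; rewrite mxE (sum_supp1 _ _ _ i) ?mxE ?eqxx ?mul1r // => l li.
by rewrite mxE val_eqE [i == l]eq_sym (negbTE li) i0 mul0r.
Qed.

Lemma mul_LmxE (K : 'M[R]_(p, N)) i k j : k = i.+1 :> nat ->
  (K *m Lmx N a) j k = a k.+1 * K j k + K j i.
Proof.
move=> ki; rewrite mxE (sum_supp2 _ _ _ _ _ (succ_neq _ _ _ ki)) ?mxE.
  by rewrite eqxx ki gtn_eqF // eqxx mulr1 addrC mulrC.
move=> l li lk; rewrite mxE ki eqSS -ki !val_eqE [k == l]eq_sym [i == l]eq_sym.
by rewrite (negbTE li) (negbTE lk) mulr0.
Qed.

Lemma mul_LmxE0 (K : 'M[R]_(p, N)) i j : i = 0%N :> nat ->
  (K *m Lmx N a) j i = a 1%N * K j i.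
Proof.
move=> i0; rewrite mxE (sum_supp1 _ _ _ i) ?mxE ?eqxx ?i0 1?mulrC // => l li.
by rewrite mxE val_eqE [i == l]eq_sym (negbTE li) i0 mulr0.
Qed.

Lemma mul_MmxE (K : 'M[R]_(p, N)) i k j : k = i.+1 :> nat ->
  (K *m Mmx N b) j i = K j i - b k * K j k.
Proof.
move=> ki; rewrite mxE (sum_supp2 _ _ _ _ _ (succ_neq _ _ _ ki)) ?mxE.
  by rewrite eqxx ki gtn_eqF // eqxx mulr1 mulrN mulrC.
by move=> l li lk; rewrite mxE -ki !val_eqE (negbTE li) (negbTE lk) mulr0.
Qed.

End BidiagonalProducts.

(** Forward substitution: row [i] of the hypothesis gives [K i j] as the identity entry plus [b i]
    times the entry one row higher. For [i <= j] that entry lies strictly above the diagonal and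
    vanishes by induction. *)
Lemma Mmx_inv_upper (R : realType) (N : nat) (b : nat -> R) (K : 'M[R]_N) :
  Mmx N b *m K = 1%:M ->
  forall i j : 'I_N, (i <= j)%N -> K i j = (i == j)%:R.
Proof.
move=> MK i; have [k] := ubnP (i : nat); elim: k => // k IHk in i * => lt_ik j.
have := congr1 (fun A : 'M_N => A i j) MK; rewrite [RHS]mxE.
case: (posnP i) => [i0|i_gt0]; first by rewrite Mmx_mulE0.
have lt_i'N : (i.-1 < N)%N by rewrite (leq_ltn_trans (leq_pred i)).
pose i' := Ordinal lt_i'N.
have ii' : i = i'.+1 :> nat by rewrite /= prednK.
rewrite (Mmx_mulE _ _ _ _ _ _ _ _ ii') => + le_ij.
have lt_i'j : (i' < j)%N by rewrite -ii'.
by rewrite (IHk i') -?ii' ?(ltnW lt_i'j) // -val_eqE ltn_eqF // mulr0 subr0.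
Qed.

Section Polynomials.
Variables (R : realType) (a b : nat -> R).

Lemma P0 : P a b 0 = 1. Proof. by []. Qed.

Lemma P1 : P a b 1 = 'X - (a 1%N)%:P.
Proof. by rewrite /P /= mulr0 mulr1 subr0. Qed.

Lemma PSS n : P a b n.+2 =
  ('X - (a n.+2)%:P) * P a b n.+1 - (b n.+1)%:P * 'X * P a b n.
Proof. by rewrite /P /=; case: (Ppair a b n). Qed.

(** In [PSS] the subtracted term has degree at most [n + 1], so it cannot disturb the leading term,
    which has degree [n + 2]. *)
Lemma P_monic_size n : P a b n \is monic /\ size (P a b n) = n.+1.
Proof.
elim/ltn_ind: n => -[|[|n]] IH; first by rewrite P0 monic1 size_poly1.
  by rewrite P1 monicXsubC size_XsubC.
have [mS sS] := IH n.+1 (ltnSn _); have [_ s] := IH n (ltnW (ltnSn _)).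
have sM : size (('X - (a n.+2)%:P) * P a b n.+1) = n.+3.
  by rewrite size_monicM ?monicXsubC ?monic_neq0 // size_XsubC sS.
have lt_s : (size (- ((b n.+1)%:P * 'X * P a b n)) < n.+3)%N.
  rewrite size_polyN -mulrA mul_polyC (leq_ltn_trans (size_scale_leq _ _)) //.
  by rewrite (leq_ltn_trans (size_polyMleq _ _)) // size_polyX s.
rewrite PSS; split; last by rewrite size_polyDl sM.
by rewrite monicE lead_coefDl ?sM // -monicE rpredM ?monicXsubC.
Qed.

Lemma P_eval_unitmx N (x : 'I_N -> R) : injective x ->
  \matrix_(i < N, j < N) (P a b i).[x j] \in unitmx.
Proof.
move=> x_inj.
(* Row [i] of [T] lists the coefficients of [P_i]; degree [i] makes it lower triangular, monicity
   puts 1 on the diagonal. *)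
pose T : 'M[R]_N := \matrix_(i, k) (P a b i)`_k.
have -> : \matrix_(i, j) (P a b i).[x j] = T *m Vandermonde N (\row_j x j).
  apply/matrixP => i j; rewrite !mxE (@horner_coef_wide _ N); last first.
    by rewrite (P_monic_size i).2.
  by apply: eq_bigr => k _; rewrite !mxE.
rewrite unitmx_mul !unitmxE !unitfE det_trig; last first.
  apply/is_trig_mxP => i k lt_ik.
  by rewrite mxE nth_default // (P_monic_size i).2.
rewrite det_Vandermonde; apply/andP; split; apply/prodf_neq0 => i _.
  rewrite mxE; have [/monicP + s] := P_monic_size i.
  by rewrite lead_coefE s => ->; rewrite oner_neq0.
apply/prodf_neq0 => j lt_ij; rewrite !mxE subr_eq0 (inj_eq x_inj).
by rewrite -val_eqE gtn_eqF.
Qed.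

Lemma right_eigenvectorE N (v : 'cV[R]_N) (z : R) :
  Lmx N a *m v = z *: (Mmx N b *m v) -> first_component1 v ->
  forall i, v i 0 = (P a b i).[z].
Proof.
move=> Lv v1 [k]; elim/ltn_ind: k => -[|k] IH ltkN.
  by rewrite v1 // hornerC.
have ltkN' := ltnW ltkN; pose i := Ordinal ltkN'.
have := congr1 (fun A : 'cV_N => A i 0) Lv.
(* The superdiagonal 1 of [Lmx] lets row [i] be solved for the next component of [v]. *)
rewrite (Lmx_mulE _ _ _ _ _ i (Ordinal ltkN)) // mxE => /(canRL (addKr _)) ->.
rewrite (IH k (ltnSn _) ltkN') /=.
case: k => [|k] in IH ltkN ltkN' @i *.
  by rewrite Mmx_mulE0 // (IH 0%N) // P0 P1 !hornerE; ring.
have ltkN2 := ltnW ltkN'.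
rewrite (Mmx_mulE _ _ _ _ _ (Ordinal ltkN2)) // (IH k.+1) // (IH k) //=.
by rewrite PSS !hornerE; ring.
Qed.

(** Column [i] gives [z b_(i+1) u_(i+1) = (z - a_(i+1)) u_i - u_(i-1)]. The factor [z^i b_1...b_i]
    absorbs these coefficients, which yields the recurrence of [P] without any division. *)
Lemma left_eigenvectorE N (u : 'cV[R]_N) (z : R) :
  u^T *m Lmx N a = z *: (u^T *m Mmx N b) -> first_component1 u ->
  forall i : 'I_N, z ^+ i * (\prod_(1 <= k < i.+1) b k) * u i 0 = (P a b i).[z].
Proof.
move=> Lu u1 [k]; elim/ltn_ind: k => -[|k] IH ltkN.
  by rewrite u1 // hornerC big_geq // expr0 !mulr1.
have ltkN' := ltnW ltkN; pose i := Ordinal ltkN'.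
have := congr1 (fun A : 'rV_N => A 0 i) Lu.
rewrite [RHS]mxE (mul_MmxE _ _ _ _ _ i (Ordinal ltkN)) //.
have := IH k (ltnSn _) ltkN'; rewrite -/i /=.
case: k => [|k] in IH ltkN ltkN' @i *.
  rewrite mul_LmxE0 // !mxE P0 P1 big_nat1 big_geq //= !hornerE /= => ->.
  rewrite mulr1 expr1 => e.
  by apply/eqP; rewrite -subr_eq0 -(subrr (a 1%N)) {1}e; apply/eqP; ring.
have ltkN2 := ltnW ltkN'; have := IH k (ltnW (ltnSn _)) ltkN2.
rewrite (mul_LmxE _ _ _ _ _ (Ordinal ltkN2)) // !mxE PSS !hornerE /=.
rewrite (big_nat_recr k.+2) // (big_nat_recr k.+1) //=.
set B := \prod_(1 <= _ < _) _ => <- <- e.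
(* The equation is solved for the earliest component, whose coefficient is 1. *)
have -> : u (Ordinal ltkN2) 0 =
    z * (u i 0 - b k.+2 * u (Ordinal ltkN) 0) - a k.+2 * u i 0.
  by rewrite -e addrC addKr.
by rewrite !exprS; ring.
Qed.

End Polynomials.

Theorem theorem2p9 (R : realType) (N : nat) (a b : nat -> R)
    (lambda w : 'I_N -> R)
    (hN : (1 <= N)%N)
    (ha : forall n : nat, (1 <= n <= N)%N -> 0 < a n)
    (hb : forall n : nat, (1 <= n <= N.-1)%N -> 0 < b n)
    (hb0 : b 0%N = 0)
    (hdata : spectral_data a b lambda w)
    (m n : nat) (hmn : (m <= n)%N) (hn : (n <= N.-1)%N) :
  \sum_(j < N) (P a b m).[lambda j] * (P a b n).[lambda j]
                 * (w j / lambda j ^+ n)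
  = (m == n)%:R * \prod_(1 <= k < n.+1) b k.
Proof.
case: hdata => lambda_gt0 lambda_incr _ weightE.
have ltnN : (n < N)%N by rewrite -(prednK hN) ltnS.
have lambda_inj : injective lambda.
  move=> i j e; apply/val_inj; case: (ltngtP i j) => // /lambda_incr;
  by rewrite e ltxx.
have [v /fin_all_exists[u uvP]] := fin_all_exists weightE.
pose V := \matrix_(i, j) v j i 0; pose U := \matrix_(j, i) u j i 0.
have colV j : col j V = v j by apply/matrixP => i k; rewrite !mxE ord1.
have rowU j : row j U = (u j)^T by apply/matrixP => i k; rewrite !mxE ord1.
have V_unit : V \in unitmx.
  rewrite (_ : V = \matrix_(i, j) (P a b i).[lambda j]) ?P_eval_unitmx //.
  apply/matrixP => i j; rewrite !mxE; have [Lv _ v1 _ _] := uvP j.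
  exact: right_eigenvectorE Lv v1 i.
pose D := U *m Mmx N b *m V.
have DE j k : D j k = ((u j)^T *m Mmx N b *m v k) 0 0.
  by rewrite -rowU -colV -!row_mul colE mulmxA -colE !mxE.
have D_diag j k : j != k -> D j k = 0.
  move=> neq_jk; have [_ uL _ _ _] := uvP j; have [Lv _ _ _ _] := uvP k.
  (* Both sides equal [u_j^T L v_k]. *)
  have : lambda k * D j k = lambda j * D j k.
    have := congr1 (mulmx (u j)^T) Lv; rewrite mulmxA uL -scalemxAl -scalemxAr.
    by move/matrixP/(_ 0 0); rewrite !mulmxA mxE [RHS]mxE -!DE.
  move/eqP; rewrite -subr_eq0 -mulrBl mulf_eq0 subr_eq0 (inj_eq lambda_inj).
  by rewrite eq_sym (negbTE neq_jk) => /eqP.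
have M_unit : Mmx N b \in unitmx.
  rewrite unitmxE det_trig; last first.
    apply/is_trig_mxP => i j ij; rewrite mxE ltn_eqF //.
    by rewrite ltn_eqF // ltnW.
  by rewrite big1 ?unitr1 // => i _; rewrite mxE eqxx.
(* If [D j j = 0], the whole row [j] of [D = U (M V)] is zero; [M V] is invertible, so [u_j = 0],
   against its first component 1. *)
have D_neq0 j : D j j != 0.
  apply/eqP => Djj0; have : row j U = 0.
    have rowD : row j U *m (Mmx N b *m V) = 0.
      rewrite mulmxA -!row_mul; apply/rowP => k.
      rewrite -/D [LHS]mxE [RHS]mxE.
      by have [<-|/D_diag] := eqVneq j k.
    have MV_unit : Mmx N b *m V \in unitmx by rewrite unitmx_mul M_unit.
    by rewrite -(mulmxK MV_unit (row j U)) rowD mul0mx.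
  move/matrixP/(_ 0 (Ordinal hN)); rewrite !mxE.
  by have [_ _ _ -> // _] := uvP j; move/eqP; rewrite oner_eq0.
pose W := diag_mx (\row_j w j).
have WUMV : W *m U *m Mmx N b *m V = 1%:M.
  rewrite -!mulmxA [U *m _]mulmxA -/D mul_diag_mx.
  apply/matrixP => j k; rewrite [LHS]mxE [RHS]mxE [X in X * _]mxE.
  have [<-|/D_diag ->] := eqVneq j k; last by rewrite mulr0.
  by have [_ _ _ _ ->] := uvP j; rewrite -DE mulVf.
(* One-sided inverses of square matrices are two-sided: this moves first [V], then [M], to the
   front. *)
have /Mmx_inv_upper MK : Mmx N b *m (V *m (W *m U)) = 1%:M.
  by apply: mulmx1C; rewrite -mulmxA; apply: mulmx1C.
have ltmN := leq_ltn_trans hmn ltnN.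
have := MK (Ordinal ltmN) (Ordinal ltnN) hmn; rewrite -val_eqE /= => <-.
rewrite mxE mulr_suml; apply: eq_bigr => j _; rewrite mul_diag_mx !mxE.
have [Lv uL v1 u1 _] := uvP j.
rewrite (right_eigenvectorE _ _ _ _ _ _ Lv v1) /=.
(* Writing [P_n(lambda_j)] through [u_j] produces the power that cancels [lambda j ^+ n] and the
   product of the [b k]. *)
rewrite -(left_eigenvectorE _ _ _ _ _ _ uL u1 (Ordinal ltnN)) /=.
have : lambda j ^+ n != 0 by rewrite expf_neq0 // gt_eqF.
by move=> lambda_n_neq0; field.
Qed.
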